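(* There is a knowing machine which possesses Knowledge of Factivity; that is, there is a knowing machine $\mathscr{M}$ such that $\mathscr{M}\models K(K(\phi)\rightarrow\phi)$ for every $\mathscr{L}(K)$-formula $\phi$.
   Context: Language. Let $\mathscr{L}$ be the first-order language of Peano Arithmetic ($PA$). The first-order language $\mathscr{L}(K)$ is defined inductively: it contains all function, constant and predicate symbols of $\mathscr{L}$, and for every formula $\phi$ of $\mathscr{L}(K)$ it contains a new $0$-ary predicate symbol $K_\phi$. Write $K(\phi)$ for $K_\phi$ (so $K(K(\phi))$ is $K_{K_\phi}$, etc.). Thus $K(\phi)$ is an atomic sentence, even if $\phi$ has free variables, and substitution for variables does not act inside $K(\cdot)$. Logic is ordinary classical first-order logic (with equality); implications associate to the right. Semantics. For a structure $\mathscr{M}$ and a formula $\phi$, $\mathscr{M}\models\phi$ means $\phi$ holds in $\mathscr{M}$ under all variable assignments; for a set $\Gamma$ of formulas, $\Gamma\models\phi$ means every model of $\Gamma$ satisfies $\phi$. The axioms of a knowing machine are the following schemas ($\phi,\psi$ ranging over $\mathscr{L}(K)$-formulas): (1) Knowledge of Tautology: $K(\phi)$ whenever $\phi$ is tautological (i.e. logically valid). (2) Knowledge Modus Ponens: $K(\phi\rightarrow\psi)\rightarrow K(\phi)\rightarrow K(\psi)$. (3) Knowledge of Arithmetic: $K(\phi)$ whenever $\phi$ is an axiom of $PA$. (4) Closure: $K(\phi)$ whenever $\phi$ is an instance of (1), (2) or (3). (5) Factivity: $K(\phi)\rightarrow\phi$. Fix a standard Gödel numbering $\phi\mapsto\ulcorner\phi\urcorner\in\mathbb{N}$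 of $\mathscr{L}(K)$-formulas. A knowing entity is an $\mathscr{L}(K)$-structure $\mathscr{M}$ with universe $\mathbb{N}$, interpreting the symbols of $PA$ as usual, such that $\mathscr{M}$ satisfies the axioms of a knowing machine. A knowing machine is a knowing entity $\mathscr{M}$ such that $\{\ulcorner\phi\urcorner : \mathscr{M}\models K(\phi)\}$ is recursively enumerable. *)

(* Defs.v *)
From Stdlib Require Import Arith List Cantor.
From Stdlib Require Fin Vector.

Inductive term : Type :=
| Var (x : nat)
| Zero
| Succ (t : term)
| Plus (t u : term)
| Times (t u : term).

(** [K phi] is the 0-ary predicate symbol indexed by the formula [phi]: it is
    atomic, and the variables of [phi] do not occur in it.  The connectives
    and, or, exists are the usual classical abbreviations. *)
Inductive formula : Type :=
| Eq (t u : term)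
| K (phi : formula)
| Not (phi : formula)
| Imp (phi psi : formula)
| All (x : nat) (phi : formula).

Declare Scope fol_scope.
Delimit Scope fol_scope with fol.
Bind Scope fol_scope with formula.
Infix "~>" := Imp (at level 55, right associativity) : fol_scope.

Fixpoint arithmetical (phi : formula) : Prop :=
  match phi with
  | Eq _ _ => True
  | K _ => False
  | Not a => arithmetical a
  | Imp a b => arithmetical a /\ arithmetical b
  | All _ a => arithmetical a
  end.

Fixpoint occurs (x : nat) (t : term) : Prop :=
  match t with
  | Var y => x = y
  | Zero => False
  | Succ t => occurs x t
  | Plus t u | Times t u => occurs x t \/ occurs x u
  end.

Fixpoint free (x : nat) (phi : formula) : Prop :=
  match phi with
  | Eq t u => occurs x t \/ occurs x u
  | K _ => False
  | Not a => free x a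
  | Imp a b => free x a \/ free x b
  | All y a => x <> y /\ free x a
  end.

Definition sentence (phi : formula) : Prop := forall x, ~ free x phi.

Fixpoint tsubst (x : nat) (s : term) (t : term) : term :=
  match t with
  | Var y => if Nat.eqb x y then s else Var y
  | Zero => Zero
  | Succ t => Succ (tsubst x s t)
  | Plus t u => Plus (tsubst x s t) (tsubst x s u)
  | Times t u => Times (tsubst x s t) (tsubst x s u)
  end.

(** Replaces the free occurrences of [x] by [s], without renaming bound
    variables.  Below [s] has no variable other than [x], so that no variable
    can be captured. *)
Fixpoint subst (x : nat) (s : term) (phi : formula) : formula :=
  match phi with
  | Eq t u => Eq (tsubst x s t) (tsubst x s u)
  | K a => K a
  | Not a => Not (subst x s a)
  | Imp a b => Imp (subst x s a) (subst x s b)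
  | All y a => if Nat.eqb x y then All y a else All y (subst x s a)
  end.

Definition induction_formula (x : nat) (phi : formula) : formula :=
  (subst x Zero phi ~> All x (phi ~> subst x (Succ (Var x)) phi) ~> All x phi)%fol.

Inductive PA_axiom : formula -> Prop :=
| PA_succ_neq0 : PA_axiom (All 0 (Not (Eq (Succ (Var 0)) Zero)))
| PA_succ_inj : PA_axiom (All 0 (All 1
    (Eq (Succ (Var 0)) (Succ (Var 1)) ~> Eq (Var 0) (Var 1))))
| PA_plus0 : PA_axiom (All 0 (Eq (Plus (Var 0) Zero) (Var 0)))
| PA_plusS : PA_axiom (All 0 (All 1
    (Eq (Plus (Var 0) (Succ (Var 1))) (Succ (Plus (Var 0) (Var 1))))))
| PA_times0 : PA_axiom (All 0 (Eq (Times (Var 0) Zero) Zero))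
| PA_timesS : PA_axiom (All 0 (All 1
    (Eq (Times (Var 0) (Succ (Var 1))) (Plus (Times (Var 0) (Var 1)) (Var 0)))))
(* Universal closures of induction formulas: parameters are allowed, but the
   schema ranges over formulas of the language of arithmetic only. *)
| PA_induction (x : nat) (phi : formula) (xs : list nat) :
    arithmetical phi ->
    sentence (fold_right All (induction_formula x phi) xs) ->
    PA_axiom (fold_right All (induction_formula x phi) xs).

(** Equality is interpreted as identity; [zero] makes the domain nonempty. *)
Record structure : Type := Structure {
  dom :> Type;
  zero : dom;
  succ : dom -> dom;
  plus : dom -> dom -> dom;
  times : dom -> dom -> dom;
  known : formula -> Prop (* interpretation of the symbols [K phi] *)
}.

Fixpoint teval (M : structure) (e : nat -> M) (t : term) : M :=
  match t with
  | Var x => e x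
  | Zero => zero M
  | Succ t => succ M (teval M e t)
  | Plus t u => plus M (teval M e t) (teval M e u)
  | Times t u => times M (teval M e t) (teval M e u)
  end.

Definition update {D : Type} (e : nat -> D) (x : nat) (d : D) : nat -> D :=
  fun y => if Nat.eqb x y then d else e y.

Fixpoint sat (M : structure) (e : nat -> M) (phi : formula) : Prop :=
  match phi with
  | Eq t u => teval M e t = teval M e u
  | K a => known M a
  | Not a => ~ sat M e a
  | Imp a b => sat M e a -> sat M e b
  | All x a => forall d : M, sat M (update e x d) a
  end.

Definition models (M : structure) (phi : formula) : Prop :=
  forall e : nat -> M, sat M e phi.

Notation "M |== phi" := (models M phi%fol) (at level 70, no associativity).

Definition valid (phi : formula) : Prop := forall M : structure, M |== phi.

Definition standard (P : formula -> Prop) : structure :=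
  Structure nat 0 S Nat.add Nat.mul P.

Inductive recfun : nat -> Type :=
| r_zero n : recfun n
| r_succ : recfun 1
| r_proj n (i : Fin.t n) : recfun n
| r_comp n m (f : recfun m) (g : Fin.t m -> recfun n) : recfun n
| r_prim n (f : recfun n) (g : recfun (S (S n))) : recfun (S n)
| r_mu n (f : recfun (S n)) : recfun n.

(** [reval f v y]: the partial recursive function [f] is defined at [v], with
    value [y].  Primitive recursion is on the first argument:
    h(0, v) = f(v) and h(i+1, v) = g(i, h(i, v), v).  Minimization is also with
    respect to the first argument, and requires all the previous values to be
    defined. *)
Fixpoint reval {n : nat} (f : recfun n) : Vector.t nat n -> nat -> Prop :=
  match f with
  | r_zero _ => fun _ y => y = 0
  | r_succ => fun v y => y = S (Vector.hd v)
  | r_proj _ i => fun v y => y = Vector.nth v i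
  | r_comp _ m f g => fun v y =>
      exists w : Vector.t nat m,
        (forall i, reval (g i) v (Vector.nth w i)) /\ reval f w y
  | r_prim _ f g => fun v y =>
      nat_rect (fun _ => nat -> Prop)
        (reval f (Vector.tl v))
        (fun i h y => exists z, h z /\
           reval g (Vector.cons _ i _ (Vector.cons _ z _ (Vector.tl v))) y)
        (Vector.hd v) y
  | r_mu _ f => fun v y =>
      reval f (Vector.cons _ y _ v) 0 /\
      forall i, i < y -> exists z, reval f (Vector.cons _ i _ v) (S z)
  end.

Definition recursively_enumerable (A : nat -> Prop) : Prop :=
  exists f : recfun 1, forall n,
    A n <-> exists y, reval f (Vector.cons _ n _ (Vector.nil _)) y.

Fixpoint tcode (t : term) : nat :=
  match t with
  | Var x => to_nat (0, x)
  | Zero => to_nat (1, 0)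
  | Succ t => to_nat (2, tcode t)
  | Plus t u => to_nat (3, to_nat (tcode t, tcode u))
  | Times t u => to_nat (4, to_nat (tcode t, tcode u))
  end.

(** [to_nat] is Cantor's pairing function. *)
Fixpoint code (phi : formula) : nat :=
  match phi with
  | Eq t u => to_nat (0, to_nat (tcode t, tcode u))
  | K a => to_nat (1, code a)
  | Not a => to_nat (2, code a)
  | Imp a b => to_nat (3, to_nat (code a, code b))
  | All x a => to_nat (4, to_nat (x, code a))
  end.

Lemma to_nat_eq (a b c d : nat) : to_nat (a, b) = to_nat (c, d) -> a = c /\ b = d.
Proof. intros H; apply to_nat_inj in H; now inversion H. Qed.

Ltac code_step :=
  repeat match goal with
  | H : to_nat _ = to_nat _ |- _ => apply to_nat_eq in H; destruct H
  end; try discriminate.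

Lemma tcode_inj (t u : term) : tcode t = tcode u -> t = u.
Proof.
revert u; induction t; intros []; cbn -[to_nat]; intros H; code_step; f_equal; auto.
Qed.

Lemma code_inj (phi psi : formula) : code phi = code psi -> phi = psi.
Proof.
revert psi; induction phi; intros []; cbn -[to_nat]; intros H; code_step;
  f_equal; auto using tcode_inj.
Qed.

Inductive basic_axiom : formula -> Prop :=
| knowledge_of_tautology phi : valid phi -> basic_axiom (K phi)
| knowledge_modus_ponens phi psi :
    basic_axiom (K (phi ~> psi) ~> K phi ~> K psi)
| knowledge_of_arithmetic phi : PA_axiom phi -> basic_axiom (K phi).

Inductive knowing_axiom : formula -> Prop :=
| basic phi : basic_axiom phi -> knowing_axiom phi
| closure phi : basic_axiom phi -> knowing_axiom (K phi)
| factivity phi : knowing_axiom (K phi ~> phi).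

Definition knowing_entity (M : structure) : Prop :=
  (exists P : formula -> Prop, M = standard P) /\
  (forall phi, knowing_axiom phi -> M |== phi).

Definition knowing_machine (M : structure) : Prop :=
  knowing_entity M /\
  recursively_enumerable (fun n => exists phi, n = code phi /\ M |== K phi).

(* Main.v *)
From Stdlib Require Import Arith Lia List Cantor.
From Stdlib Require Fin Vector.
From Stdlib Require Import Classical ClassicalEpsilon FunctionalExtensionality
  PropExtensionality ProofIrrelevance.
Require Import Defs.
Import ListNotations.

(** The machine knows the closure under modus ponens of the following formulas:
    the theorems of PA, with induction for all the formulas of the language with
    K, the formulas [K phi] with [phi] such a theorem, the distribution axioms,
    and all the [K phi ~> phi].  What has to be shown is that this set [knows]
    is factive and that it is recursively enumerable.

    Factivity looks circular, since the truth of the axioms [K phi ~> phi] is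
    the factivity to be proved.  It is not, because [K phi] is an atom whose
    subscript is a smaller formula: the truth of [phi] in [standard P] depends
    only on the members of [P] of smaller K-depth than [phi] ([sat_depth]).
    By induction on n, the known formulas of depth less than n are true in
    [standard knows].  Let [knows_upto n] be the closure of the theorems and of
    these formulas under modus ponens.  It agrees with [knows] below depth n, hence all its members
    are true in [standard (knows_upto n)], and so all the axioms of [knows] are
    true there, the factivity axioms included.  Therefore every known formula is
    true in [standard (knows_upto n)], and those of depth n are then also true
    in [standard knows] ([knows_sound]).

    Recursive enumerability rests on a completeness theorem: the set of theorems
    of PA must contain all valid formulas, and be enumerable.  Here a theorem is
    a formula whose negation is refuted by a finite semantic tree, which branches
    on the truth value of arbitrary claims about Henkin names, and each of whose
    branches contains one of finitely many kinds of local conflict ([refuted]).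
    The names contain the witnesses, so that no freshness condition and no
    substitution is involved.  An unrefuted claim extends to a saturated
    valuation, whose names modulo the affirmed equalities form a model of PA
    ([valid_provable], [PA_provable]); conversely the names have values in the
    standard structures, where no conflict is true ([provable_sound]).

    Finally, the definitions of [refuted] and [knows] are transcribed into a
    logic program over numbers built with Cantor's pairing function.  For every
    such program the derivable facts are recursively enumerable: a certificate
    for the resolution of a goal can be checked primitive recursively
    ([recursively_enumerable_derivable]). *)

(** * Primitive recursive functions *)

(** The closure lemmas below compose functions pointwise, so that the programs
    of the class [recfun] never have to be written down. *)
Definition primrec {n : nat} (F : Vector.t nat n -> nat) : Prop :=
  exists f : recfun n, forall v y, reval f v y <-> y = F v.

Lemma primrec_ext n (F G : Vector.t nat n -> nat) :
  (forall v, F v = G v) -> primrec F -> primrec G.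
Proof. intros E [f Hf]; exists f; intros v y; now rewrite Hf, E. Qed.

Lemma primrec_zero n : primrec (fun _ : Vector.t nat n => 0).
Proof. now exists (r_zero n). Qed.

Lemma primrec_nth n (i : Fin.t n) : primrec (fun v => Vector.nth v i).
Proof. now exists (r_proj n i). Qed.

Lemma primrec_comp n m (F : Vector.t nat m -> nat) (W : Vector.t nat n -> Vector.t nat m) :
  primrec F -> (forall i, primrec (fun v => Vector.nth (W v) i)) ->
  primrec (fun v => F (W v)).
Proof.
intros [f Hf] HW.
pose (g i := proj1_sig (constructive_indefinite_description _ (HW i))).
assert (Hg : forall i v y, reval (g i) v y <-> y = Vector.nth (W v) i)
  by (intros i; apply (proj2_sig (constructive_indefinite_description _ (HW i)))).
exists (r_comp n m f g); intros v y; cbn; split.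
- intros (w & Hw & H); apply Hf in H; subst y; f_equal.
  apply Vector.eq_nth_iff; intros i ? <-; now apply Hg.
- intros ->; exists (W v); split; [intros i; now apply Hg | now apply Hf].
Qed.

Lemma primrec_hd n : primrec (fun v : Vector.t nat (S n) => Vector.hd v).
Proof.
apply primrec_ext with (2 := primrec_nth (S n) Fin.F1).
intros v; now rewrite (Vector.eta v).
Qed.

Lemma nth_tl A n (v : Vector.t A (S n)) i :
  Vector.nth (Vector.tl v) i = Vector.nth v (Fin.FS i).
Proof. now rewrite (Vector.eta v). Qed.

Lemma primrec_tl n (F : Vector.t nat n -> nat) :
  primrec F -> primrec (fun v => F (Vector.tl v)).
Proof.
intros H; apply (primrec_comp _ _ F (fun v => Vector.tl v)); [exact H|].
intros i; apply primrec_ext with (2 := primrec_nth _ (Fin.FS i)).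
intros v; symmetry; apply nth_tl.
Qed.

Lemma primrec_tl2 n (F : Vector.t nat n -> nat) :
  primrec F -> primrec (fun v => F (Vector.tl (Vector.tl v))).
Proof. intros H; now apply (primrec_tl _ (fun v => F (Vector.tl v))), primrec_tl. Qed.

Lemma primrec_cons n (F : Vector.t nat (S n) -> nat) (G : Vector.t nat n -> nat) :
  primrec F -> primrec G -> primrec (fun v => F (Vector.cons _ (G v) _ v)).
Proof.
intros HF HG; apply (primrec_comp _ _ F (fun v => Vector.cons _ (G v) _ v)); [exact HF|].
intros i; apply (Fin.caseS' i); cbn; [exact HG | apply primrec_nth].
Qed.

Lemma primrec_succ n (F : Vector.t nat n -> nat) :
  primrec F -> primrec (fun v => S (F v)).
Proof.
intros H.
apply (primrec_comp n 1 (fun w => S (Vector.hd w))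
         (fun v => Vector.cons _ (F v) _ (Vector.nil _))).
- now exists r_succ.
- intros i; apply (Fin.caseS' i); cbn; [exact H | intros j; inversion j].
Qed.

Lemma primrec_rec n (B N : Vector.t nat n -> nat) (R : nat -> nat -> Vector.t nat n -> nat) :
  primrec B ->
  primrec (fun w => R (Vector.hd w) (Vector.hd (Vector.tl w)) (Vector.tl (Vector.tl w))) ->
  primrec N ->
  primrec (fun v => nat_rect (fun _ => nat) (B v) (fun i h => R i h v) (N v)).
Proof.
intros [f Hf] [g Hg] HN.
apply (primrec_cons n (fun w => nat_rect (fun _ => nat) (B (Vector.tl w))
         (fun i h => R i h (Vector.tl w)) (Vector.hd w)) N); [|exact HN].
exists (r_prim n f g); intros w; cbn.
induction (Vector.hd w) as [|i IH]; intros y; cbn; [apply Hf|].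
split.
- intros (z & Hz & H); apply IH in Hz; apply Hg in H; now subst.
- intros ->; eexists; split; [now apply IH | now apply Hg].
Qed.

Lemma primrec_const n c : primrec (fun _ : Vector.t nat n => c).
Proof. induction c; [apply primrec_zero | now apply primrec_succ]. Qed.

Lemma primrec_pred n (F : Vector.t nat n -> nat) :
  primrec F -> primrec (fun v => pred (F v)).
Proof.
intros H.
apply primrec_ext with (F := fun v => nat_rect (fun _ => nat) 0 (fun i _ => i) (F v)).
- intros v; now destruct (F v).
- apply (primrec_rec n (fun _ => 0) F (fun i _ _ => i));
    auto using primrec_zero, primrec_hd.
Qed.

Lemma primrec_add n (F G : Vector.t nat n -> nat) :
  primrec F -> primrec G -> primrec (fun v => F v + G v).
Proof.
intros HF HG.
apply primrec_ext with (F := fun v => nat_rect (fun _ => nat) (G v) (fun _ h => S h) (F v)).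
- intros v; induction (F v); cbn; congruence.
- apply (primrec_rec n G F (fun _ h _ => S h)); auto.
  apply primrec_succ.
  apply (primrec_tl _ (fun w => Vector.hd w)), primrec_hd.
Qed.

Lemma primrec_sub n (F G : Vector.t nat n -> nat) :
  primrec F -> primrec G -> primrec (fun v => F v - G v).
Proof.
intros HF HG.
apply primrec_ext with (F := fun v => nat_rect (fun _ => nat) (F v) (fun _ h => pred h) (G v)).
- intros v; induction (G v); cbn; lia.
- apply (primrec_rec n F G (fun _ h _ => pred h)); auto.
  apply primrec_pred.
  apply (primrec_tl _ (fun w => Vector.hd w)), primrec_hd.
Qed.

Definition if_zero (c a b : nat) : nat := match c with 0 => a | S _ => b end.

Lemma primrec_if_zero n (C A B : Vector.t nat n -> nat) :
  primrec C -> primrec A -> primrec B ->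
  primrec (fun v => if_zero (C v) (A v) (B v)).
Proof.
intros HC HA HB.
apply primrec_ext with (F := fun v => nat_rect (fun _ => nat) (A v) (fun _ _ => B v) (C v)).
- intros v; now destruct (C v).
- apply (primrec_rec n A C (fun _ _ v => B v)); auto.
  now apply primrec_tl2.
Qed.

Definition if_eq (x y a b : nat) : nat := if_zero ((x - y) + (y - x)) a b.

Lemma if_eq_spec x y a b : if_eq x y a b = if Nat.eqb x y then a else b.
Proof.
unfold if_eq; destruct (Nat.eqb_spec x y) as [->|H]; [now rewrite Nat.sub_diag|].
destruct (x - y + (y - x)) eqn:E; [lia | reflexivity].
Qed.

Lemma primrec_if_eq n (X Y A B : Vector.t nat n -> nat) :
  primrec X -> primrec Y -> primrec A -> primrec B ->
  primrec (fun v => if_eq (X v) (Y v) (A v) (B v)).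
Proof.
intros; apply primrec_if_zero; auto.
apply primrec_add; now apply primrec_sub.
Qed.

(** The following functions invert the pairing function by arithmetic:
    [to_nat (x, y)] lies [y] above the triangular number of its diagonal
    [y + x]. *)
Definition triangle (n : nat) : nat := nat_rect (fun _ => nat) 0 (fun i h => S i + h) n.

Lemma primrec_triangle n (F : Vector.t nat n -> nat) :
  primrec F -> primrec (fun v => triangle (F v)).
Proof.
intros H; apply (primrec_rec n (fun _ => 0) F (fun i h _ => S i + h)); auto using primrec_zero.
apply primrec_add; [apply primrec_succ, primrec_hd|].
apply (primrec_tl _ (fun w => Vector.hd w)), primrec_hd.
Qed.

Lemma to_nat_triangle x y : to_nat (x, y) = y + triangle (y + x).
Proof. reflexivity. Qed.

Lemma primrec_pair n (F G : Vector.t nat n -> nat) :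
  primrec F -> primrec G -> primrec (fun v => to_nat (F v, G v)).
Proof.
intros HF HG.
apply primrec_ext with (F := fun v => G v + triangle (G v + F v)); [reflexivity|].
apply primrec_add; [auto | apply primrec_triangle, primrec_add; auto].
Qed.

Definition diagonal (n : nat) : nat :=
  nat_rect (fun _ => nat) 0 (fun i d => if_eq (S i) (triangle (S d)) (S d) d) n.

Lemma diagonal_bounds n : triangle (diagonal n) <= n < triangle (S (diagonal n)).
Proof.
induction n as [|n IH]; [cbn; lia|].
change (diagonal (S n)) with
  (if_eq (S n) (triangle (S (diagonal n))) (S (diagonal n)) (diagonal n)).
rewrite if_eq_spec; destruct (Nat.eqb_spec (S n) (triangle (S (diagonal n)))) as [E|E].
- change (triangle (S (S (diagonal n)))) with
    (S (S (diagonal n)) + triangle (S (diagonal n))); lia.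
- lia.
Qed.

Lemma triangle_le a b : a <= b -> triangle a <= triangle b.
Proof. induction 1; [lia|]; change (triangle (S m)) with (S m + triangle m); lia. Qed.

Lemma diagonal_pair x y : diagonal (to_nat (x, y)) = y + x.
Proof.
pose proof (diagonal_bounds (to_nat (x, y))) as H.
rewrite to_nat_triangle in H at 2 3; set (d := diagonal (to_nat (x, y))) in *.
assert (triangle (S (y + x)) = S (y + x) + triangle (y + x)) by reflexivity.
destruct (Nat.lt_trichotomy d (y + x)) as [L|[L|L]]; [|exact L|].
- pose proof (triangle_le (S d) (y + x) L); lia.
- pose proof (triangle_le (S (y + x)) d L); lia.
Qed.

Lemma primrec_diagonal n (F : Vector.t nat n -> nat) :
  primrec F -> primrec (fun v => diagonal (F v)).
Proof.
intros H; apply (primrec_rec n (fun _ => 0) F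
  (fun i d _ => if_eq (S i) (triangle (S d)) (S d) d)); auto using primrec_zero.
pose proof (primrec_tl _ (fun w : Vector.t nat (S n) => Vector.hd w) (primrec_hd _)).
apply primrec_if_eq; auto using primrec_triangle, primrec_succ, primrec_hd.
Qed.

Definition cfst (n : nat) : nat := fst (of_nat n).
Definition csnd (n : nat) : nat := snd (of_nat n).

Lemma cfst_pair x y : cfst (to_nat (x, y)) = x.
Proof. unfold cfst; now rewrite cancel_of_to. Qed.

Lemma csnd_pair x y : csnd (to_nat (x, y)) = y.
Proof. unfold csnd; now rewrite cancel_of_to. Qed.

Lemma pair_cfst_csnd n : to_nat (cfst n, csnd n) = n.
Proof. unfold cfst, csnd; rewrite <- surjective_pairing; apply cancel_to_of. Qed.

Lemma csnd_diagonal n : csnd n = n - triangle (diagonal n).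
Proof.
rewrite <- (pair_cfst_csnd n) at 2 3.
rewrite diagonal_pair, to_nat_triangle; lia.
Qed.

Lemma cfst_diagonal n : cfst n = diagonal n - csnd n.
Proof. rewrite <- (pair_cfst_csnd n) at 2; rewrite diagonal_pair; lia. Qed.

Lemma primrec_csnd n (F : Vector.t nat n -> nat) :
  primrec F -> primrec (fun v => csnd (F v)).
Proof.
intros H; apply primrec_ext with (F := fun v => F v - triangle (diagonal (F v))).
- intros v; now rewrite csnd_diagonal.
- auto using primrec_sub, primrec_triangle, primrec_diagonal.
Qed.

Lemma primrec_cfst n (F : Vector.t nat n -> nat) :
  primrec F -> primrec (fun v => cfst (F v)).
Proof.
intros H; apply primrec_ext with (F := fun v => diagonal (F v) - csnd (F v)).
- intros v; now rewrite cfst_diagonal.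
- auto using primrec_sub, primrec_csnd, primrec_diagonal.
Qed.

(** Every number is read as an infinite sequence, the heads of its iterated
    second components.  A code of a finite list continues with zeros, the
    default value of [nth]: the pair of two zeros is zero. *)
Fixpoint tail (c k : nat) : nat :=
  match k with 0 => c | S k => csnd (tail c k) end.

Definition entry (c k : nat) : nat := cfst (tail c k).

Lemma primrec_entry n (C I : Vector.t nat n -> nat) :
  primrec C -> primrec I -> primrec (fun v => entry (C v) (I v)).
Proof.
intros HC HI; apply primrec_cfst.
apply primrec_ext with (F := fun v => nat_rect (fun _ => nat) (C v) (fun _ h => csnd h) (I v)).
- intros v; induction (I v); cbn; congruence.
- apply (primrec_rec n C I (fun _ h _ => csnd h)); auto.
  apply primrec_csnd, (primrec_tl _ (fun w => Vector.hd w)), primrec_hd.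
Qed.

Definition sequence (l : list nat) : nat := fold_right (fun a c => to_nat (a, c)) 0 l.

Lemma entry_sequence l k : entry (sequence l) k = nth k l 0.
Proof.
assert (E : forall k c, tail c (S k) = tail (csnd c) k).
{ induction k0; intros c; [reflexivity|].
  change (csnd (tail c (S k0)) = csnd (tail (csnd c) k0)); now rewrite IHk0. }
unfold entry; revert k; induction l as [|a l IH]; intros k.
- replace (tail (sequence []) k) with 0; [now destruct k|].
  induction k as [|k IH]; [reflexivity|]; rewrite E; exact IH.
- destruct k as [|k]; [apply cfst_pair|].
  rewrite E; change (sequence (a :: l)) with (to_nat (a, sequence l)).
  rewrite csnd_pair; apply IH.
Qed.

Lemma exists_least (X : nat -> Prop) :
  (exists d, X d) -> exists d, X d /\ forall c, c < d -> ~ X c.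
Proof.
intros [d Hd]; revert Hd; induction d as [d IH] using lt_wf_ind; intros Hd.
destruct (classic (exists c, c < d /\ X c)) as [(c & L & Hc)|N]; [eauto|].
exists d; split; [exact Hd|]; intros c L Hc; eauto.
Qed.

(** Minimization halts exactly when there is a zero, because the function being
    searched is total. *)
Lemma recursively_enumerable_exists_zero (F : nat -> nat -> nat) :
  primrec (fun v : Vector.t nat 2 => F (Vector.hd (Vector.tl v)) (Vector.hd v)) ->
  recursively_enumerable (fun n => exists m, F n m = 0).
Proof.
intros [f Hf]; exists (r_mu 1 f); intros n; split.
- intros H; destruct (exists_least _ H) as (m & Hm & L); exists m; split.
  + now apply Hf.
  + intros i Hi; specialize (L i Hi); exists (pred (F n i)); apply Hf; cbn; lia.
- intros (m & Hm & _); apply Hf in Hm; now exists m.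
Qed.

(** * Logic programs *)

Inductive pattern : Type :=
| PVar (k : nat)
| PNum (n : nat)
| PSucc (p : pattern)
| PPair (p q : pattern).

Fixpoint instance (r : nat -> nat) (p : pattern) : nat :=
  match p with
  | PVar k => r k
  | PNum n => n
  | PSucc p => S (instance r p)
  | PPair p q => to_nat (instance r p, instance r q)
  end.

Lemma instance_ext r r' p : (forall k, r k = r' k) -> instance r p = instance r' p.
Proof. intros E; induction p; cbn [instance]; congruence. Qed.

Record rule : Type := Rule { conclusion : pattern; premises : list pattern }.

(** The variables of a rule are instantiated by the sequence that a number [c]
    codes, so that a rule application is a finite object. *)
Inductive derivable (program : list rule) : nat -> Prop :=
| derive (R : rule) (c : nat) : In R program ->
    (forall p, In p (premises R) -> derivable program (instance (entry c) p)) ->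
    derivable program (instance (entry c) (conclusion R)).

Lemma derive_list program R (l : list nat) :
  In R program ->
  (forall p, In p (premises R) ->
     derivable program (instance (fun k => nth k l 0) p)) ->
  derivable program (instance (fun k => nth k l 0) (conclusion R)).
Proof.
intros HR H.
assert (E : forall p, instance (entry (sequence l)) p = instance (fun k => nth k l 0) p)
  by (intros; apply instance_ext, entry_sequence).
rewrite <- E; apply derive; [exact HR|]; intros p Hp; rewrite E; auto.
Qed.

(** Goal stacks are coded as numbers.  The successor separates a nonempty stack
    from the empty stack 0. *)
Definition push (a s : nat) : nat := S (to_nat (a, s)).

Definition resolve (R : rule) (c rest : nat) : nat :=
  fold_right (fun p s => push (instance (entry c) p) s) rest (premises R).

Definition rest_of (s : nat) : nat := csnd (pred s).

(** Rule number [j] is applied to the top goal if the instance of its conclusion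
    matches it, and the stack is left unchanged otherwise.  A certificate may
    therefore contain arbitrary steps and still be sound. *)
Fixpoint attempt (program : list rule) (j c s : nat) : nat :=
  match program with
  | [] => s
  | R :: program =>
      if_zero j
        (if_eq s (push (instance (entry c) (conclusion R)) (rest_of s))
           (resolve R c (rest_of s)) s)
        (attempt program (pred j) c s)
  end.

Definition step (program : list rule) (d s : nat) : nat :=
  attempt program (cfst d) (csnd d) s.

Definition search (program : list rule) (d k s : nat) : nat :=
  nat_rect (fun _ => nat) s (fun i s => step program (entry d i) s) k.

Lemma primrec_instance n (C : Vector.t nat n -> nat) p :
  primrec C -> primrec (fun v => instance (entry (C v)) p).
Proof.
intros H; induction p; cbn [instance];
  auto using primrec_entry, primrec_const, primrec_succ, primrec_pair.
Qed.

Lemma primrec_push n (F G : Vector.t nat n -> nat) :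
  primrec F -> primrec G -> primrec (fun v => push (F v) (G v)).
Proof. intros; now apply primrec_succ, primrec_pair. Qed.

Lemma primrec_attempt n program (J C X : Vector.t nat n -> nat) :
  primrec J -> primrec C -> primrec X ->
  primrec (fun v => attempt program (J v) (C v) (X v)).
Proof.
intros HJ HC HX; revert J HJ; induction program as [|R program IH]; intros J HJ;
  [exact HX|].
assert (HR : primrec (fun v => rest_of (X v))) by now apply primrec_csnd, primrec_pred.
apply primrec_if_zero; [exact HJ | | now apply (IH (fun v => pred (J v))), primrec_pred].
apply primrec_if_eq; [auto | now apply primrec_push; [apply primrec_instance|] | | auto].
unfold resolve; induction (premises R); cbn [fold_right]; [exact HR|].
now apply primrec_push; [apply primrec_instance|].
Qed.

Lemma primrec_search n program (D N X : Vector.t nat n -> nat) :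
  primrec D -> primrec N -> primrec X ->
  primrec (fun v => search program (D v) (N v) (X v)).
Proof.
intros HD HN HX.
apply (primrec_rec n X N (fun i s v => step program (entry (D v) i) s)); auto.
assert (primrec (fun w : Vector.t nat (S (S n)) =>
          entry (D (Vector.tl (Vector.tl w))) (Vector.hd w))).
{ apply primrec_entry; [now apply primrec_tl2 | apply primrec_hd]. }
apply primrec_attempt; [now apply primrec_cfst | now apply primrec_csnd|].
apply (primrec_tl _ (fun w => Vector.hd w)), primrec_hd.
Qed.

Lemma push_inj a s b t : push a s = push b t -> a = b /\ s = t.
Proof. intros H; apply to_nat_eq; unfold push in H; congruence. Qed.

Inductive all_derivable (program : list rule) : nat -> Prop :=
| all_nil : all_derivable program 0
| all_push a s : derivable program a -> all_derivable program s ->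
    all_derivable program (push a s).

Lemma all_derivable_push program a s :
  all_derivable program (push a s) -> derivable program a /\ all_derivable program s.
Proof.
remember (push a s) as u eqn:E; intros H; destruct H as [|b t Hb Ht]; [discriminate E|].
now apply push_inj in E as [<- <-].
Qed.

Lemma all_derivable_resolve program R c s :
  all_derivable program (resolve R c s) ->
  (forall p, In p (premises R) -> derivable program (instance (entry c) p)) /\
  all_derivable program s.
Proof.
unfold resolve; induction (premises R) as [|q l IH]; cbn [fold_right In]; intros H.
- split; [now intros ? [] | exact H].
- apply all_derivable_push in H as [Ha Ht].
  destruct (IH Ht) as [H1 H2]; split; [|exact H2].
  intros p [<-|Hp]; auto.
Qed.

(** Soundness of resolution runs backwards: from the goals that replace a goal
    to the goal. *)
Lemma step_sound program d s :
  all_derivable program (step program d s) -> all_derivable program s.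
Proof.
unfold step; generalize (cfst d) as j, (csnd d) as c; intros j c.
assert (G : forall P, incl P program ->
   all_derivable program (attempt P j c s) -> all_derivable program s).
{ intros P; revert j; induction P as [|R P IH]; intros j HP; cbn [attempt]; [auto|].
  destruct j as [|j]; cbn [if_zero].
  - rewrite if_eq_spec; destruct (Nat.eqb_spec s
      (push (instance (entry c) (conclusion R)) (rest_of s))) as [E|_]; [|auto].
    intros H; apply all_derivable_resolve in H as [H1 H2].
    rewrite E; constructor; [|exact H2].
    constructor; [apply HP; now left | exact H1].
  - apply IH; intros ? ?; apply HP; now right. }
apply G, incl_refl.
Qed.

Inductive reduces (program : list rule) : nat -> nat -> Prop :=
| reduces_refl s : reduces program s s
| reduces_step d s t :
    reduces program (step program d s) t -> reduces program s t.

Lemma reduces_trans program s t u :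
  reduces program s t -> reduces program t u -> reduces program s u.
Proof. induction 1; [auto|]; intros; eapply reduces_step; eauto. Qed.

Lemma step_complete program R c s : In R program ->
  exists d, step program d (push (instance (entry c) (conclusion R)) s) = resolve R c s.
Proof.
intros HR.
assert (G : exists j, attempt program j c
          (push (instance (entry c) (conclusion R)) s) = resolve R c s).
{ induction program as [|R' P IH]; [destruct HR|]; destruct HR as [->|HR].
  - exists 0; cbn [attempt if_zero].
    replace (rest_of (push _ s)) with s
      by (unfold rest_of, push; cbn [pred]; now rewrite csnd_pair).
    now rewrite if_eq_spec, Nat.eqb_refl.
  - destruct (IH HR) as [j Hj]; now exists (S j). }
destruct G as [j Hj]; exists (to_nat (j, c)); unfold step.
now rewrite cfst_pair, csnd_pair.
Qed.

Lemma derivable_reduces program n : derivable program n ->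
  forall s, reduces program (push n s) s.
Proof.
induction 1 as [R c HR _ IH]; intros s.
destruct (step_complete program R c s HR) as [d Hd].
apply reduces_step with d; rewrite Hd; clear d Hd.
unfold resolve; induction (premises R) as [|p l IHl]; cbn [fold_right];
  [constructor|].
eapply reduces_trans; [apply IH; now left|].
apply IHl; intros q Hq; apply IH; now right.
Qed.

Lemma search_spec program s :
  (exists m, search program (cfst m) (csnd m) s = 0) <-> reduces program s 0.
Proof.
split.
- intros [m H]; revert H; generalize (cfst m) as d, (csnd m) as k; clear m; intros d k.
  assert (G : reduces program s (search program d k s)).
  { induction k as [|k IH]; [constructor|].
    eapply reduces_trans; [exact IH|].
    eapply reduces_step, reduces_refl. }
  now intros <-.
- intros H.
  assert (G : exists l, fold_left (fun s d => step program d s) l s = 0).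
  { remember 0 as z in H; induction H as [s|d s t _ IH]; [now exists []|].
    destruct (IH Heqz) as [l Hl]; now exists (d :: l). }
  destruct G as [l Hl]; exists (to_nat (sequence l, length l)).
  rewrite cfst_pair, csnd_pair, <- Hl.
  clear Hl H.
  rewrite <- (firstn_all l) at 3.
  assert (G : forall k, k <= length l ->
    search program (sequence l) k s = fold_left (fun s d => step program d s) (firstn k l) s);
    [|now apply G].
  induction k as [|k IH]; intros Hk; [reflexivity|].
  cbn [search nat_rect]; fold (search program (sequence l) k s).
  rewrite IH by lia; rewrite entry_sequence.
  replace (firstn (S k) l) with (firstn k l ++ [nth k l 0]).
  + now rewrite fold_left_app.
  + clear IH; revert l Hk; induction k as [|k IH]; intros [|a l] Hk; cbn in *;
      [lia | reflexivity | lia | rewrite <- IH by lia; reflexivity].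
Qed.

(** A goal is derivable if and only if some certificate empties the stack that
    holds this goal alone. *)
Lemma recursively_enumerable_derivable program p :
  recursively_enumerable (fun n => derivable program (to_nat (p, n))).
Proof.
assert (E : (fun n => derivable program (to_nat (p, n))) =
   fun n => exists m, search program (cfst m) (csnd m) (push (to_nat (p, n)) 0) = 0).
{ apply functional_extensionality; intros n; apply propositional_extensionality.
  rewrite search_spec; split; [intros; now apply derivable_reduces|].
  intros H.
  assert (G : all_derivable program (push (to_nat (p, n)) 0)).
  { remember 0 as z in H at 2.
    induction H; [subst; constructor | eauto using step_sound]. }
  now apply all_derivable_push in G. }
rewrite E; apply recursively_enumerable_exists_zero.
assert (primrec (fun v : Vector.t nat 2 => Vector.hd (Vector.tl v)))
  by apply (primrec_tl _ (fun w => Vector.hd w)), primrec_hd.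
apply primrec_search; auto using primrec_cfst, primrec_csnd, primrec_hd.
apply primrec_push; [apply primrec_pair|]; auto using primrec_const.
Qed.

(** * Semantic trees for Peano Arithmetic *)

(** Names denote the elements of a Henkin model.  [NWit x phi e] is a witness
    that [All x phi] fails under [e], the least one in a standard structure, and
    [NPred] is the predecessor.  A name records the whole environment of its
    formula, so that witnesses never have to be chosen fresh. *)
Inductive name : Type :=
| NFree (x : nat)
| NZero
| NSucc (a : name)
| NPlus (a b : name)
| NTimes (a b : name)
| NPred (a : name)
| NWit (x : nat) (phi : formula) (e : env)
with env : Type :=
| ENil
| ECons (x : nat) (a : name) (e : env).

(** A variable outside the environment is its own name: this makes [ENil] the
    generic assignment. *)
Fixpoint lookup (e : env) (x : nat) : name :=
  match e with
  | ENil => NFree x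
  | ECons y a e => if Nat.eqb y x then a else lookup e x
  end.

Definition herbrand : structure :=
  Structure name NZero NSucc NPlus NTimes (fun _ => False).

Definition term_name (e : env) (t : term) : name := teval herbrand (lookup e) t.

(** Formulas are paired with environments in place of substituting names in
    them, which removes every question of variable capture. *)
Inductive claim : Type :=
| Equal (a b : name)
| Holds (e : env) (phi : formula).

Notation signed := (bool * claim)%type (only parsing).
Notation yes A := (true, A) (only parsing).
Notation no A := (false, A) (only parsing).

(** The first conflicts say that the claims on formulas obey the truth conditions; [conflict_known] that
    [K phi] does not depend on the environment.  [conflict_least] and
    [conflict_pred] are the induction schema, as a least number principle: if
    the witness is not zero, then it is the successor of a number that is no
    counterexample.  The remaining ones are the axioms of equality and of
    successor, addition and multiplication. *)
Inductive conflict : list signed -> Prop :=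
| conflict_sign A : conflict [yes A; no A]
| conflict_eq_yes e t u :
    conflict [yes (Holds e (Eq t u)); no (Equal (term_name e t) (term_name e u))]
| conflict_eq_no e t u :
    conflict [no (Holds e (Eq t u)); yes (Equal (term_name e t) (term_name e u))]
| conflict_known e e' phi : conflict [yes (Holds e (K phi)); no (Holds e' (K phi))]
| conflict_not_yes e phi : conflict [yes (Holds e (Not phi)); yes (Holds e phi)]
| conflict_not_no e phi : conflict [no (Holds e (Not phi)); no (Holds e phi)]
| conflict_imp_yes e phi psi :
    conflict [yes (Holds e (Imp phi psi)); yes (Holds e phi); no (Holds e psi)]
| conflict_imp_left e phi psi : conflict [no (Holds e (Imp phi psi)); no (Holds e phi)]
| conflict_imp_right e phi psi : conflict [no (Holds e (Imp phi psi)); yes (Holds e psi)]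
| conflict_all_yes e x phi a :
    conflict [yes (Holds e (All x phi)); no (Holds (ECons x a e) phi)]
| conflict_all_no e x phi :
    conflict [no (Holds e (All x phi)); yes (Holds (ECons x (NWit x phi e) e) phi)]
| conflict_least e x phi :
    conflict [no (Holds e (All x phi)); no (Equal (NWit x phi e) NZero);
              no (Holds (ECons x (NPred (NWit x phi e)) e) phi)]
| conflict_pred a : conflict [no (Equal a NZero); no (Equal a (NSucc (NPred a)))]
| conflict_refl a : conflict [no (Equal a a)]
| conflict_euclid a b c :
    conflict [yes (Equal a b); yes (Equal a c); no (Equal b c)]
| conflict_succ a b : conflict [yes (Equal a b); no (Equal (NSucc a) (NSucc b))]
| conflict_plus a b c d :
    conflict [yes (Equal a b); yes (Equal c d); no (Equal (NPlus a c) (NPlus b d))]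
| conflict_times a b c d :
    conflict [yes (Equal a b); yes (Equal c d); no (Equal (NTimes a c) (NTimes b d))]
| conflict_succ_zero a : conflict [yes (Equal (NSucc a) NZero)]
| conflict_succ_inj a b : conflict [yes (Equal (NSucc a) (NSucc b)); no (Equal a b)]
| conflict_plus0 a : conflict [no (Equal (NPlus a NZero) a)]
| conflict_plusS a b : conflict [no (Equal (NPlus a (NSucc b)) (NSucc (NPlus a b)))]
| conflict_times0 a : conflict [no (Equal (NTimes a NZero) NZero)]
| conflict_timesS a b :
    conflict [no (Equal (NTimes a (NSucc b)) (NPlus (NTimes a b) a))].

(** A semantic tree whose branches all contain a conflict.  Splitting on an
    arbitrary claim is a cut rule; it makes an open branch decide every claim. *)
Inductive refuted (s : list signed) : Prop :=
| refuted_conflict l : conflict l -> incl l s -> refuted s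
| refuted_split A : refuted (yes A :: s) -> refuted (no A :: s) -> refuted s.

Definition provable (phi : formula) : Prop := refuted [no (Holds ENil phi)].

(** * Soundness of semantic trees *)

Definition least (X : nat -> Prop) : nat :=
  epsilon (inhabits 0) (fun d => X d /\ forall c, c < d -> ~ X c).

Lemma least_spec X : (exists d, X d) -> X (least X) /\ forall c, c < least X -> ~ X c.
Proof.
intros H; apply (epsilon_spec (inhabits 0) (fun d => X d /\ forall c, c < d -> ~ X c)).
now apply exists_least.
Qed.

(** The value of a witness is the least counterexample, which makes induction
    true whatever the interpretation [P] of the symbols K. *)
Fixpoint nvalue (P : formula -> Prop) (e0 : nat -> nat) (a : name) : nat :=
  match a with
  | NFree x => e0 x
  | NZero => 0
  | NSucc a => S (nvalue P e0 a)
  | NPlus a b => nvalue P e0 a + nvalue P e0 b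
  | NTimes a b => nvalue P e0 a * nvalue P e0 b
  | NPred a => pred (nvalue P e0 a)
  | NWit x phi e =>
      least (fun d => ~ sat (standard P) (update (evalue P e0 e) x d) phi)
  end
with evalue (P : formula -> Prop) (e0 : nat -> nat) (e : env) : nat -> nat :=
  match e with
  | ENil => e0
  | ECons x a e => update (evalue P e0 e) x (nvalue P e0 a)
  end.

Definition true_claim P e0 (A : claim) : Prop :=
  match A with
  | Equal a b => nvalue P e0 a = nvalue P e0 b
  | Holds e phi => sat (standard P) (evalue P e0 e) phi
  end.

Definition true_signed P e0 (A : signed) : Prop :=
  if fst A then true_claim P e0 (snd A) else ~ true_claim P e0 (snd A).

Lemma nvalue_lookup P e0 e x : nvalue P e0 (lookup e x) = evalue P e0 e x.
Proof.
induction e as [|y a e IH]; [reflexivity|]; cbn; unfold update.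
now destruct (Nat.eqb y x).
Qed.

Lemma nvalue_term_name P e0 e t :
  nvalue P e0 (term_name e t) = teval (standard P) (evalue P e0 e) t.
Proof.
unfold term_name; induction t; cbn; [apply nvalue_lookup | | | |]; congruence.
Qed.

Lemma conflict_sound P e0 l : conflict l -> ~ Forall (true_signed P e0) l.
Proof.
assert (W : forall e x phi, ~ sat (standard P) (evalue P e0 e) (All x phi) ->
  let w := nvalue P e0 (NWit x phi e) in
  ~ sat (standard P) (update (evalue P e0 e) x w) phi /\
  forall c, c < w -> sat (standard P) (update (evalue P e0 e) x c) phi).
{ intros e x phi H.
  destruct (least_spec (fun d => ~ sat (standard P) (update (evalue P e0 e) x d) phi))
    as [H1 H2].
  - apply not_all_ex_not; exact H.
  - split; [exact H1|]; intros c Hc; apply NNPP; exact (H2 c Hc). }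
intros C H.
destruct C; repeat (apply Forall_cons_iff in H as [?H H]); clear H;
  unfold true_signed in *; cbn [fst snd true_claim] in *;
  try (cbn [sat teval nvalue] in *; rewrite ?nvalue_term_name in *; tauto || lia).
- apply H1; cbn [evalue]; auto.
- apply W in H0; now destruct H0.
- apply W in H0; cbn [evalue nvalue] in *; destruct H0 as [_ H0].
  apply H2, H0; lia.
Qed.

Lemma refuted_sound P e0 s : refuted s -> ~ Forall (true_signed P e0) s.
Proof.
induction 1 as [s l C I|s A _ IH1 _ IH2]; intros H.
- apply (conflict_sound P e0 l C); rewrite Forall_forall in *; auto.
- destruct (classic (true_claim P e0 A)) as [HA|HA];
    [apply IH1 | apply IH2]; now constructor.
Qed.

(** Soundness for an arbitrary [P] is essential: factivity is proved by changing
    the interpretation of K. *)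
Lemma provable_sound P phi : provable phi -> standard P |== phi.
Proof.
intros H e; apply NNPP; intros N.
apply (refuted_sound P e _ H); now repeat constructor.
Qed.

(** * Completeness of semantic trees *)

(** Codes serve to enumerate the claims along a branch, and later to represent
    them in a logic program. *)
Fixpoint ncode (a : name) : nat :=
  match a with
  | NFree x => to_nat (0, x)
  | NZero => to_nat (1, 0)
  | NSucc a => to_nat (2, ncode a)
  | NPlus a b => to_nat (3, to_nat (ncode a, ncode b))
  | NTimes a b => to_nat (4, to_nat (ncode a, ncode b))
  | NPred a => to_nat (5, ncode a)
  | NWit x phi e => to_nat (6, to_nat (x, to_nat (code phi, ecode e)))
  end
with ecode (e : env) : nat :=
  match e with
  | ENil => to_nat (0, 0)
  | ECons x a e => to_nat (1, to_nat (x, to_nat (ncode a, ecode e)))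
  end.

Definition ccode (A : claim) : nat :=
  match A with
  | Equal a b => to_nat (0, to_nat (ncode a, ncode b))
  | Holds e phi => to_nat (1, to_nat (ecode e, code phi))
  end.

Scheme name_env_ind := Induction for name Sort Prop
  with env_name_ind := Induction for env Sort Prop.
Combined Scheme name_env_mutind from name_env_ind, env_name_ind.

Lemma ncode_ecode_inj :
  (forall a b, ncode a = ncode b -> a = b) /\ (forall e f, ecode e = ecode f -> e = f).
Proof.
apply name_env_mutind.
all: intros; match goal with |- _ = ?b => destruct b end;
  cbn [ncode ecode] in *; code_step; f_equal; auto using code_inj.
Qed.

Definition ncode_inj := proj1 ncode_ecode_inj.
Definition ecode_inj := proj2 ncode_ecode_inj.

Lemma ccode_inj A B : ccode A = ccode B -> A = B.
Proof.
destruct A, B; cbn [ccode]; intros H; code_step; f_equal;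
  auto using ncode_inj, ecode_inj, code_inj.
Qed.

Definition saturated (V : claim -> Prop) : Prop :=
  forall l, conflict l ->
    ~ Forall (fun A : signed => if fst A then V (snd A) else ~ V (snd A)) l.

Definition extend (s : list signed) (A : claim) : list signed :=
  if excluded_middle_informative (refuted (yes A :: s)) then no A :: s else yes A :: s.

(** Stage n of an open branch decides the claim with code n, if there is one. *)
Fixpoint branch (s : list signed) (n : nat) : list signed :=
  match n with
  | 0 => s
  | S n =>
      match excluded_middle_informative (exists A, ccode A = n) with
      | left H =>
          extend (branch s n) (proj1_sig (constructive_indefinite_description _ H))
      | right _ => branch s n
      end
  end.

Lemma branch_open s n : ~ refuted s -> ~ refuted (branch s n).
Proof.
intros Hs; induction n as [|n IH]; cbn [branch]; [exact Hs|].
destruct (excluded_middle_informative _) as [H|_]; [|exact IH].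
destruct (constructive_indefinite_description _ H) as [A ?]; cbn [proj1_sig].
unfold extend; destruct (excluded_middle_informative _) as [R|R]; [|exact R].
intros R'; apply IH; now apply (refuted_split _ A).
Qed.

Lemma branch_incl s m n : m <= n -> incl (branch s m) (branch s n).
Proof.
induction 1 as [|n _ IH]; [apply incl_refl|]; cbn [branch].
destruct (excluded_middle_informative _) as [H|_]; [|exact IH].
unfold extend; destruct (excluded_middle_informative _); now apply incl_tl.
Qed.

Lemma branch_decides s A : exists b, In (b, A) (branch s (S (ccode A))).
Proof.
cbn [branch]; destruct (excluded_middle_informative _) as [H|N].
- destruct (constructive_indefinite_description _ H) as [B E]; cbn [proj1_sig].
  apply ccode_inj in E; subst B.
  unfold extend; destruct (excluded_middle_informative _); eexists; now left.
- destruct N; now exists A.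
Qed.

(** The claims that a branch affirms form a saturated valuation, since a
    conflict among finitely many of its signed claims would appear at a finite
    stage and refute it. *)
Lemma saturated_extension s : ~ refuted s ->
  exists V, saturated V /\ forall A, In (no A) s -> ~ V A.
Proof.
intros Hs; pose (U B := exists n, In B (branch s n)).
assert (HU : forall l, Forall U l -> exists n, incl l (branch s n)).
{ induction 1 as [|B l [n Hn] _ [m Hm]]; [exists 0; easy|].
  exists (max n m); intros C [<-|HC].
  - apply (branch_incl s n); [lia | exact Hn].
  - apply (branch_incl s m); [lia | auto]. }
assert (Hconf : forall l, conflict l -> ~ Forall U l).
{ intros l C H; destruct (HU l H) as [n Hn].
  apply (branch_open s n Hs); now apply (refuted_conflict _ l). }
exists (fun A => U (yes A)); split.
- intros l C H; apply (Hconf l C); revert H; apply Forall_impl.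
  intros [[|] A]; cbn [fst snd]; [auto|]; intros N.
  destruct (branch_decides s A) as [[|] Hb]; [destruct N|]; eexists; exact Hb.
- intros A HA HV; apply (Hconf _ (conflict_sign A)).
  constructor; [exact HV|]; constructor; [now exists 0 | constructor].
Qed.

(** Elements of the canonical model are equivalence classes of names, so that
    equality can be interpreted as identity. *)
Definition class (V : claim -> Prop) : Type :=
  {X : name -> Prop | exists a, X = fun b => V (Equal a b)}.

Definition class_of (V : claim -> Prop) (a : name) : class V :=
  exist _ (fun b => V (Equal a b)) (ex_intro _ a eq_refl).

Definition repr {V : claim -> Prop} (X : class V) : name :=
  proj1_sig (constructive_indefinite_description _ (proj2_sig X)).

Definition canonical (V : claim -> Prop) : structure :=
  Structure (class V) (class_of V NZero)
    (fun X => class_of V (NSucc (repr X)))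
    (fun X Y => class_of V (NPlus (repr X) (repr Y)))
    (fun X Y => class_of V (NTimes (repr X) (repr Y)))
    (fun phi => V (Holds ENil (K phi))).

Lemma class_of_repr V (X : class V) : class_of V (repr X) = X.
Proof.
destruct X as [X HX]; apply subset_eq_compat; symmetry.
exact (proj2_sig (constructive_indefinite_description _ HX)).
Qed.

Lemma class_of_all V (Q : canonical V -> Prop) :
  (forall a, Q (class_of V a)) -> forall X, Q X.
Proof. intros H X; rewrite <- (class_of_repr V X); apply H. Qed.

(* refute derives a contradiction from the conflict C, saturate proves a claim that
   C denies. *)
Ltac refute C :=
  match goal with HV : saturated _ |- _ =>
    apply (HV _ C); repeat constructor; cbn [fst snd]; auto end.
Ltac saturate C := apply NNPP; intro; refute C.

Lemma class_of_eq V a b : saturated V ->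
  (class_of V a = class_of V b :> canonical V <-> V (Equal a b)).
Proof.
intros HV.
assert (R : forall a, V (Equal a a)) by (intros c; saturate (conflict_refl c)).
assert (T : forall a b c, V (Equal a b) -> V (Equal a c) -> V (Equal b c))
  by (intros c d f H1 H2; saturate (conflict_euclid c d f)).
split.
- intros E; apply (f_equal (@proj1_sig _ _)) in E; cbn in E.
  now apply (f_equal (fun f => f b)) in E; rewrite E.
- intros H; apply subset_eq_compat.
  apply functional_extensionality; intros c; apply propositional_extensionality.
  split; intros H'; [now apply (T a) | apply (T b); [apply (T a); auto | auto]].
Qed.

Lemma repr_class_of V a : saturated V -> V (Equal (repr (class_of V a)) a).
Proof. intros HV; apply class_of_eq; [exact HV | apply class_of_repr]. Qed.

Lemma canonical_succ V a : saturated V ->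
  succ (canonical V) (class_of V a) = class_of V (NSucc a).
Proof.
intros HV; apply class_of_eq; [exact HV|].
pose proof (repr_class_of V a HV).
saturate (conflict_succ (repr (class_of V a)) a).
Qed.

Lemma canonical_plus V a b : saturated V ->
  plus (canonical V) (class_of V a) (class_of V b) = class_of V (NPlus a b).
Proof.
intros HV; apply class_of_eq; [exact HV|].
pose proof (repr_class_of V a HV); pose proof (repr_class_of V b HV).
saturate (conflict_plus (repr (class_of V a)) a (repr (class_of V b)) b).
Qed.

Lemma canonical_times V a b : saturated V ->
  times (canonical V) (class_of V a) (class_of V b) = class_of V (NTimes a b).
Proof.
intros HV; apply class_of_eq; [exact HV|].
pose proof (repr_class_of V a HV); pose proof (repr_class_of V b HV).
saturate (conflict_times (repr (class_of V a)) a (repr (class_of V b)) b).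
Qed.

Lemma canonical_teval V e t : saturated V ->
  teval (canonical V) (fun x => class_of V (lookup e x)) t = class_of V (term_name e t).
Proof.
intros HV; unfold term_name; induction t; cbn [teval]; [reflexivity | reflexivity | | |].
- rewrite IHt; now apply canonical_succ.
- rewrite IHt1, IHt2; now apply canonical_plus.
- rewrite IHt1, IHt2; now apply canonical_times.
Qed.

Lemma update_lookup V e x a :
  update (D := canonical V) (fun y => class_of V (lookup e y)) x (class_of V a) =
  fun y => class_of V (lookup (ECons x a e) y).
Proof.
apply functional_extensionality; intros y; unfold update; cbn [lookup].
now destruct (Nat.eqb x y).
Qed.

(** The truth lemma.  It concerns the assignments that come from an environment;
    these are closed under updates, because every element has a name. *)
Lemma canonical_sat V phi e : saturated V ->
  (sat (canonical V) (fun x => class_of V (lookup e x)) phi <-> V (Holds e phi)).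
Proof.
intros HV; revert e; induction phi as [t u|phi _|phi IH|phi IH1 psi IH2|x phi IH]; intros e;
  cbn [sat].
- rewrite !canonical_teval, class_of_eq by exact HV; split; intros H.
  + saturate (conflict_eq_no e t u).
  + saturate (conflict_eq_yes e t u).
- split; intros H.
  + saturate (conflict_known ENil e phi).
  + saturate (conflict_known e ENil phi).
- rewrite IH; split; intros H.
  + saturate (conflict_not_no e phi).
  + intros H'; refute (conflict_not_yes e phi).
- rewrite IH1, IH2; split; intros H.
  + apply NNPP; intros N.
    assert (~ V (Holds e psi)) by (intros ?; refute (conflict_imp_right e phi psi)).
    apply N; exfalso; refute (conflict_imp_left e phi psi).
  + intros H'; saturate (conflict_imp_yes e phi psi).
- split.
  + intros H; apply NNPP; intros N.
    specialize (H (class_of V (NWit x phi e))).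
    rewrite update_lookup, IH in H; refute (conflict_all_no e x phi).
  + intros H; refine (class_of_all V _ _); intros a; rewrite update_lookup, IH.
    saturate (conflict_all_yes e x phi a).
Qed.

Lemma provable_complete phi :
  (forall V, saturated V ->
     sat (canonical V) (fun x => class_of V (lookup ENil x)) phi) ->
  provable phi.
Proof.
intros H; apply NNPP; intros N.
destruct (saturated_extension _ N) as (V & HV & HN).
apply (HN (Holds ENil phi)); [now left|].
now apply canonical_sat, H.
Qed.

Lemma valid_provable phi : valid phi -> provable phi.
Proof. intros H; apply provable_complete; intros V _; apply H. Qed.

Lemma teval_tsubst (M : structure) (e : nat -> M) x s t :
  teval M e (tsubst x s t) = teval M (update e x (teval M e s)) t.
Proof.
induction t; cbn; try congruence.
unfold update; now destruct (Nat.eqb x x0).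
Qed.

Lemma update_update D (e : nat -> D) x d d' :
  update (update e x d) x d' = update e x d'.
Proof.
apply functional_extensionality; intros y; unfold update; now destruct (Nat.eqb x y).
Qed.

Lemma update_comm D (e : nat -> D) x y d d' : x <> y ->
  update (update e x d) y d' = update (update e y d') x d.
Proof.
intros N; apply functional_extensionality; intros z; unfold update.
destruct (Nat.eqb_spec x z), (Nat.eqb_spec y z); congruence.
Qed.

Lemma teval_update (M : structure) (e : nat -> M) y d t :
  ~ occurs y t -> teval M (update e y d) t = teval M e t.
Proof.
induction t; cbn [occurs teval]; intros H;
  rewrite ?IHt, ?IHt1, ?IHt2 by tauto; try reflexivity.
unfold update; destruct (Nat.eqb_spec y x); congruence.
Qed.

(** The hypothesis excludes capture: a quantifier that could bind a variable of
    [s] binds [x], and then [subst] does not go under it. *)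
Lemma sat_subst (M : structure) x s phi (e : nat -> M) :
  (forall y, occurs y s -> y = x) ->
  (sat M e (subst x s phi) <-> sat M (update e x (teval M e s)) phi).
Proof.
intros Hs; revert e; induction phi as [t u|phi _|phi IH|phi IH1 psi IH2|y phi IH];
  intros e; cbn [subst sat].
- now rewrite !teval_tsubst.
- reflexivity.
- now rewrite IH.
- now rewrite IH1, IH2.
- destruct (Nat.eqb_spec x y) as [<-|N]; cbn [sat].
  + split; intros H d; specialize (H d); now rewrite update_update in *.
  + assert (E : forall d, sat M (update e y d) (subst x s phi) <->
                  sat M (update (update e x (teval M e s)) y d) phi).
    { intros d; rewrite IH, teval_update, update_comm; [reflexivity | congruence |].
      intros O; apply N; now rewrite (Hs y O). }
    now split; intros H d; apply E.
Qed.

Lemma sat_induction_formula (M : structure) (e : nat -> M) x phi :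
  (sat M (update e x (zero M)) phi ->
   (forall d, sat M (update e x d) phi -> sat M (update e x (succ M d)) phi) ->
   forall d, sat M (update e x d) phi) ->
  sat M e (induction_formula x phi).
Proof.
intros H H0 HS; cbn [sat] in *; rewrite sat_subst in H0 by (intros ? []).
apply H; [exact H0|]; intros d Hd.
specialize (HS d Hd); rewrite sat_subst in HS by (cbn; auto).
cbn [teval] in HS; rewrite update_update in HS; unfold update at 2 in HS.
now rewrite Nat.eqb_refl in HS.
Qed.

(** If [phi] failed somewhere then its witness would be a least counterexample:
    it is not zero, so it is the successor of its predecessor, for which [phi]
    holds. *)
Lemma canonical_induction V e x phi : saturated V ->
  sat (canonical V) (fun x => class_of V (lookup e x)) (induction_formula x phi).
Proof.
intros HV; apply sat_induction_formula; intros H0 HS.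
change (sat (canonical V) (fun x => class_of V (lookup e x)) (All x phi)).
apply canonical_sat; [exact HV|]; apply NNPP; intros N.
set (w := NWit x phi e).
assert (Hw : ~ V (Holds (ECons x w e) phi)) by (intros ?; refute (conflict_all_no e x phi)).
rewrite <- canonical_sat, <- update_lookup in Hw by exact HV.
assert (Hnz : ~ V (Equal w NZero)).
{ intros E; apply (class_of_eq V) in E; [|exact HV]; apply Hw; rewrite E; exact H0. }
assert (Hp : V (Holds (ECons x (NPred w) e) phi)) by saturate (conflict_least e x phi).
rewrite <- canonical_sat, <- update_lookup in Hp by exact HV.
apply HS in Hp; rewrite canonical_succ in Hp by exact HV.
assert (E : V (Equal w (NSucc (NPred w)))) by saturate (conflict_pred w).
apply (class_of_eq V) in E; [|exact HV]; apply Hw; rewrite E; exact Hp.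
Qed.

(** By completeness it is enough that the axioms hold in the canonical models.
    Universal closures are treated under an arbitrary environment, since the
    quantifiers extend it. *)
Lemma PA_provable phi : PA_axiom phi -> provable phi.
Proof.
intros H; apply provable_complete; intros V HV.
generalize ENil; destruct H as [| | | | | |x phi xs _ _]; intros e.
7: { revert e; induction xs as [|y xs IH]; intros e;
       [now apply canonical_induction|].
     refine (class_of_all V _ _); intros a; rewrite update_lookup; apply IH. }
all: cbn [sat teval update Nat.eqb]; refine (class_of_all V _ _); intros a.
all: try (refine (class_of_all V _ _); intros b).
all: change (zero (canonical V)) with (class_of V NZero).
all: rewrite ?canonical_succ, ?canonical_plus, ?canonical_times, ?canonical_succ,
  ?canonical_plus by exact HV.
all: rewrite ?class_of_eq by exact HV.
- intros E; refute (conflict_succ_zero a).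
- intros E; saturate (conflict_succ_inj a b).
- saturate (conflict_plus0 a).
- saturate (conflict_plusS a b).
- saturate (conflict_times0 a).
- saturate (conflict_timesS a b).
Qed.

(** * The machine and its factivity *)

(** The axioms [K phi] of knowledge of tautology and of arithmetic are known by
    [knows_known], as closure demands. *)
Inductive knows : formula -> Prop :=
| knows_provable phi : provable phi -> knows phi
| knows_known phi : provable phi -> knows (K phi)
| knows_distribution phi psi : knows (K (phi ~> psi) ~> K phi ~> K psi)
| knows_factivity phi : knows (K phi ~> phi)
| knows_modus_ponens phi psi : knows (phi ~> psi) -> knows phi -> knows psi.

Fixpoint K_depth (phi : formula) : nat :=
  match phi with
  | Eq _ _ => 0
  | K a => S (K_depth a)
  | Not a => K_depth a
  | Imp a b => Nat.max (K_depth a) (K_depth b)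
  | All _ a => K_depth a
  end.

(** The only symbols [K psi] in [phi] have [psi] of smaller depth. *)
Lemma sat_depth P Q phi e :
  (forall psi, K_depth psi < K_depth phi -> (P psi <-> Q psi)) ->
  (sat (standard P) e phi <-> sat (standard Q) e phi).
Proof.
revert e; induction phi as [t u|phi _|phi IH|phi IH1 psi IH2|x phi IH]; intros e H;
  cbn [sat K_depth] in *.
- assert (E : forall t, teval (standard P) e t = teval (standard Q) e t)
    by (induction t0; cbn in *; congruence).
  now rewrite !E.
- apply H; lia.
- now rewrite IH.
- rewrite IH1, IH2; [reflexivity | |]; intros; apply H; lia.
- now split; intros A d; apply IH; auto.
Qed.

(** The approximation of [knows] that is factive as soon as the known formulas
    of depth less than n are true: it is generated by them and the theorems. *)
Inductive knows_upto (n : nat) : formula -> Prop :=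
| upto_provable phi : provable phi -> knows_upto n phi
| upto_shallow phi : knows phi -> K_depth phi < n -> knows_upto n phi
| upto_modus_ponens phi psi :
    knows_upto n (phi ~> psi) -> knows_upto n phi -> knows_upto n psi.

Lemma knows_upto_iff n phi : K_depth phi < n -> (knows phi <-> knows_upto n phi).
Proof.
intros D; split; [intros; now apply upto_shallow|]; clear D.
induction 1; eauto using knows_provable, knows_modus_ponens.
Qed.

(** The truth of a known formula is first shown in [standard (knows_upto n)],
    where the factivity axioms hold by the induction hypothesis, and then moved
    to [standard knows], as the two structures agree on formulas of depth n. *)
Lemma knows_sound phi : knows phi -> standard knows |== phi.
Proof.
assert (G : forall n phi, K_depth phi < n -> knows phi -> standard knows |== phi);
  [|intros; apply (G (S (K_depth phi))); auto].
induction n as [|n IH]; intros psi D Hpsi; [lia|].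
(* The truth of the shallow known formulas passes from knows to knows_upto n,
   since the two agree below depth n. *)
assert (T : forall chi, knows_upto n chi -> standard (knows_upto n) |== chi).
{ induction 1 as [chi H|chi H Hd|chi xi _ IH1 _ IH2]; intros e.
  - now apply provable_sound.
  - apply (sat_depth knows); [intros; apply knows_upto_iff; lia | now apply IH].
  - exact (IH1 e (IH2 e)). }
assert (A : standard (knows_upto n) |== psi).
{ clear D; induction Hpsi as [chi H|chi H|chi xi|chi|chi xi _ IH1 _ IH2]; intros e.
  - now apply provable_sound.
  - now apply upto_provable.
  - exact (upto_modus_ponens n chi xi).
  - intros H; now apply T.
  - exact (IH1 e (IH2 e)). }
intros e; apply (sat_depth knows (knows_upto n)); [|apply A].
intros; apply knows_upto_iff; lia.
Qed.

Lemma basic_axiom_knows phi : basic_axiom phi -> knows phi.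
Proof.
destruct 1; [apply knows_known | apply knows_distribution | apply knows_known];
  auto using valid_provable, PA_provable.
Qed.

Lemma knows_knowing_axiom phi : knowing_axiom phi -> standard knows |== phi.
Proof.
destruct 1; intros e.
- now apply knows_sound, basic_axiom_knows.
- now apply basic_axiom_knows.
- intros H; now apply knows_sound.
Qed.

(** * A logic program for knowledge *)

Definition scode (A : signed) : nat := to_nat (if fst A then 1 else 0, ccode (snd A)).

Fixpoint lcode (s : list signed) : nat :=
  match s with
  | [] => to_nat (0, 0)
  | A :: s => to_nat (1, to_nat (scode A, lcode s))
  end.

Notation "<{ p ; .. ; q ; r }>" := (PPair p .. (PPair q r) ..).
Notation "# n" := (PNum n) (at level 1, format "# n").
Notation v0 := (PVar 0) (only parsing).
Notation v1 := (PVar 1) (only parsing).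
Notation v2 := (PVar 2) (only parsing).
Notation v3 := (PVar 3) (only parsing).
Notation v4 := (PVar 4) (only parsing).

(** The patterns of the codes of the constructors.  Terms and names share the
    tags of their common constructors. *)
Notation pVar x := <{ #0; x }> (only parsing).
Notation pZero := <{ #1; #0 }> (only parsing).
Notation pSucc a := <{ #2; a }> (only parsing).
Notation pPlus a b := <{ #3; a; b }> (only parsing).
Notation pTimes a b := <{ #4; a; b }> (only parsing).
Notation pPred a := <{ #5; a }> (only parsing).
Notation pWit x a e := <{ #6; x; a; e }> (only parsing).
Notation pEq t u := <{ #0; t; u }> (only parsing).
Notation pK a := <{ #1; a }> (only parsing).
Notation pNot a := <{ #2; a }> (only parsing).
Notation pImp a b := <{ #3; a; b }> (only parsing).
Notation pAll x a := <{ #4; x; a }> (only parsing).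
Notation pENil := <{ #0; #0 }> (only parsing).
Notation pECons x a e := <{ #1; x; a; e }> (only parsing).
Notation pEqual a b := <{ #0; a; b }> (only parsing).
Notation pHolds e a := <{ #1; e; a }> (only parsing).
Notation pyes A := <{ #1; A }> (only parsing).
Notation pno A := <{ #0; A }> (only parsing).
Notation pNil := <{ #0; #0 }> (only parsing).
Notation pCons A s := <{ #1; A; s }> (only parsing).

Fixpoint plist (l : list pattern) : pattern :=
  match l with
  | [] => pNil
  | A :: l => pCons A (plist l)
  end.

(** The predicates of the program are numbered; a fact is the pair of such a
    number and of the arguments. *)
Notation s_distinct := 0 (only parsing).
Notation s_lookup := 1 (only parsing).
Notation s_evaluates := 2 (only parsing).
Notation s_term := 3 (only parsing).
Notation s_formula := 4 (only parsing).
Notation s_name := 5 (only parsing).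
Notation s_env := 6 (only parsing).
Notation s_claim := 7 (only parsing).
Notation s_member := 8 (only parsing).
Notation s_included := 9 (only parsing).
Notation s_conflict := 10 (only parsing).
Notation s_refuted := 11 (only parsing).
Notation s_provable := 12 (only parsing).
Notation s_knows := 13 (only parsing).

Notation distinct x y := <{ #s_distinct; x; y }> (only parsing).
Notation looks_up e x a := <{ #s_lookup; e; x; a }> (only parsing).
Notation evaluates e t a := <{ #s_evaluates; e; t; a }> (only parsing).
Notation is_term t := <{ #s_term; t }> (only parsing).
Notation is_formula a := <{ #s_formula; a }> (only parsing).
Notation is_name a := <{ #s_name; a }> (only parsing).
Notation is_env e := <{ #s_env; e }> (only parsing).
Notation is_claim A := <{ #s_claim; A }> (only parsing).
Notation is_member A s := <{ #s_member; A; s }> (only parsing).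
Notation is_included l s := <{ #s_included; l; s }> (only parsing).
Notation is_conflict l := <{ #s_conflict; l }> (only parsing).
Notation is_refuted s := <{ #s_refuted; s }> (only parsing).
Notation is_provable a := <{ #s_provable; a }> (only parsing).
Notation is_known a := <{ #s_knows; a }> (only parsing).

Notation "c <-- l" := (Rule c l) (at level 70).

Definition syntax_rules : list rule :=
  [ is_term (pVar v0) <-- [];
    is_term pZero <-- [];
    is_term (pSucc v0) <-- [is_term v0];
    is_term (pPlus v0 v1) <-- [is_term v0; is_term v1];
    is_term (pTimes v0 v1) <-- [is_term v0; is_term v1];
    is_formula (pEq v0 v1) <-- [is_term v0; is_term v1];
    is_formula (pK v0) <-- [is_formula v0];
    is_formula (pNot v0) <-- [is_formula v0];
    is_formula (pImp v0 v1) <-- [is_formula v0; is_formula v1];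
    is_formula (pAll v0 v1) <-- [is_formula v1];
    is_name (pVar v0) <-- [];
    is_name pZero <-- [];
    is_name (pSucc v0) <-- [is_name v0];
    is_name (pPlus v0 v1) <-- [is_name v0; is_name v1];
    is_name (pTimes v0 v1) <-- [is_name v0; is_name v1];
    is_name (pPred v0) <-- [is_name v0];
    is_name (pWit v0 v1 v2) <-- [is_formula v1; is_env v2];
    is_env pENil <-- [];
    is_env (pECons v0 v1 v2) <-- [is_name v1; is_env v2];
    is_claim (pEqual v0 v1) <-- [is_name v0; is_name v1];
    is_claim (pHolds v0 v1) <-- [is_env v0; is_formula v1] ].

Definition evaluation_rules : list rule :=
  [ distinct #0 (PSucc v0) <-- [];
    distinct (PSucc v0) #0 <-- [];
    distinct (PSucc v0) (PSucc v1) <-- [distinct v0 v1];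
    looks_up pENil v0 (pVar v0) <-- [];
    looks_up (pECons v0 v1 v2) v0 v1 <-- [];
    looks_up (pECons v0 v1 v2) v3 v4 <-- [distinct v0 v3; looks_up v2 v3 v4];
    evaluates v0 (pVar v1) v2 <-- [looks_up v0 v1 v2];
    evaluates v0 pZero pZero <-- [];
    evaluates v0 (pSucc v1) (pSucc v2) <-- [evaluates v0 v1 v2];
    evaluates v0 (pPlus v1 v2) (pPlus v3 v4)
      <-- [evaluates v0 v1 v3; evaluates v0 v2 v4];
    evaluates v0 (pTimes v1 v2) (pTimes v3 v4)
      <-- [evaluates v0 v1 v3; evaluates v0 v2 v4] ].

Definition conflict_rules : list rule :=
  [ is_conflict (plist [pyes v0; pno v0]) <-- [];
    is_conflict (plist [pyes (pHolds v0 (pEq v1 v2)); pno (pEqual v3 v4)])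
      <-- [evaluates v0 v1 v3; evaluates v0 v2 v4];
    is_conflict (plist [pno (pHolds v0 (pEq v1 v2)); pyes (pEqual v3 v4)])
      <-- [evaluates v0 v1 v3; evaluates v0 v2 v4];
    is_conflict (plist [pyes (pHolds v0 (pK v2)); pno (pHolds v1 (pK v2))]) <-- [];
    is_conflict (plist [pyes (pHolds v0 (pNot v1)); pyes (pHolds v0 v1)]) <-- [];
    is_conflict (plist [pno (pHolds v0 (pNot v1)); pno (pHolds v0 v1)]) <-- [];
    is_conflict (plist [pyes (pHolds v0 (pImp v1 v2)); pyes (pHolds v0 v1);
                        pno (pHolds v0 v2)]) <-- [];
    is_conflict (plist [pno (pHolds v0 (pImp v1 v2)); pno (pHolds v0 v1)]) <-- [];
    is_conflict (plist [pno (pHolds v0 (pImp v1 v2)); pyes (pHolds v0 v2)]) <-- [];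
    is_conflict (plist [pyes (pHolds v0 (pAll v1 v2)); pno (pHolds (pECons v1 v3 v0) v2)])
      <-- [];
    is_conflict (plist [pno (pHolds v0 (pAll v1 v2));
                        pyes (pHolds (pECons v1 (pWit v1 v2 v0) v0) v2)]) <-- [];
    is_conflict (plist [pno (pHolds v0 (pAll v1 v2)); pno (pEqual (pWit v1 v2 v0) pZero);
                        pno (pHolds (pECons v1 (pPred (pWit v1 v2 v0)) v0) v2)]) <-- [];
    is_conflict (plist [pno (pEqual v0 pZero); pno (pEqual v0 (pSucc (pPred v0)))]) <-- [];
    is_conflict (plist [pno (pEqual v0 v0)]) <-- [];
    is_conflict (plist [pyes (pEqual v0 v1); pyes (pEqual v0 v2); pno (pEqual v1 v2)])
      <-- [];
    is_conflict (plist [pyes (pEqual v0 v1); pno (pEqual (pSucc v0) (pSucc v1))]) <-- [];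
    is_conflict (plist [pyes (pEqual v0 v1); pyes (pEqual v2 v3);
                        pno (pEqual (pPlus v0 v2) (pPlus v1 v3))]) <-- [];
    is_conflict (plist [pyes (pEqual v0 v1); pyes (pEqual v2 v3);
                        pno (pEqual (pTimes v0 v2) (pTimes v1 v3))]) <-- [];
    is_conflict (plist [pyes (pEqual (pSucc v0) pZero)]) <-- [];
    is_conflict (plist [pyes (pEqual (pSucc v0) (pSucc v1)); pno (pEqual v0 v1)]) <-- [];
    is_conflict (plist [pno (pEqual (pPlus v0 pZero) v0)]) <-- [];
    is_conflict (plist [pno (pEqual (pPlus v0 (pSucc v1)) (pSucc (pPlus v0 v1)))]) <-- [];
    is_conflict (plist [pno (pEqual (pTimes v0 pZero) pZero)]) <-- [];
    is_conflict (plist [pno (pEqual (pTimes v0 (pSucc v1)) (pPlus (pTimes v0 v1) v0))])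
      <-- [] ].

(** In a refutation only the claim of a split is guarded: without the guard
    the tree could split on a number that is no claim. *)
Definition proof_rules : list rule :=
  [ is_member v0 (pCons v0 v1) <-- [];
    is_member v0 (pCons v1 v2) <-- [is_member v0 v2];
    is_included pNil v0 <-- [];
    is_included (pCons v0 v1) v2 <-- [is_member v0 v2; is_included v1 v2];
    is_refuted v0 <-- [is_conflict v1; is_included v1 v0];
    is_refuted v0
      <-- [is_claim v1; is_refuted (pCons (pyes v1) v0); is_refuted (pCons (pno v1) v0)];
    is_provable v0 <-- [is_formula v0; is_refuted (plist [pno (pHolds pENil v0)])];
    is_known v0 <-- [is_provable v0];
    is_known (pK v0) <-- [is_provable v0];
    is_known (pImp (pK (pImp v0 v1)) (pImp (pK v0) (pK v1)))
      <-- [is_formula v0; is_formula v1];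
    is_known (pImp (pK v0) v0) <-- [is_formula v0];
    is_known v1 <-- [is_known (pImp v0 v1); is_known v0] ].

Definition program : list rule :=
  syntax_rules ++ evaluation_rules ++ conflict_rules ++ proof_rules.

(** The invariant for soundness.  Variables of a rule range over all numbers,
    also those that code nothing.  Therefore the facts of some predicates assert
    that their arguments are codes, and those of the others are implications
    from this assumption. *)
Definition meaning (n : nat) : Prop :=
  let a := csnd n in
  match cfst n with
  | s_distinct => cfst a <> csnd a
  | s_lookup => forall e, cfst a = ecode e ->
           csnd (csnd a) = ncode (lookup e (cfst (csnd a)))
  | s_evaluates => forall e t, cfst a = ecode e -> cfst (csnd a) = tcode t ->
           csnd (csnd a) = ncode (term_name e t)
  | s_term => exists t, a = tcode t
  | s_formula => exists phi, a = code phi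
  | s_name => exists b, a = ncode b
  | s_env => exists e, a = ecode e
  | s_claim => exists A, a = ccode A
  | s_member => forall s, csnd a = lcode s -> exists A, cfst a = scode A /\ In A s
  | s_included => forall s, csnd a = lcode s -> exists l, cfst a = lcode l /\ incl l s
  | s_conflict => forall l, a = lcode l -> conflict l
  | s_refuted => forall s, a = lcode s -> refuted s
  | s_provable => exists phi, a = code phi /\ provable phi
  | s_knows => exists phi, a = code phi /\ knows phi
  | _ => True
  end.

(* Unification must compare codes by their arguments, not compute them. *)
Opaque to_nat.

Definition sound_rule (R : rule) : Prop :=
  forall r, Forall (fun p => meaning (instance r p)) (premises R) ->
    meaning (instance r (conclusion R)).

Lemma scode_inj A B : scode A = scode B -> A = B.
Proof.
destruct A as [b A], B as [c B]; unfold scode; cbn [fst snd]; intros H.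
apply to_nat_eq in H as [H1 H2]; apply ccode_inj in H2.
f_equal; [destruct b, c; congruence | exact H2].
Qed.

Ltac start_rules :=
  repeat first [apply Forall_nil | apply Forall_cons];
  intros r H; cbn [premises conclusion plist] in *;
  repeat (apply Forall_cons_iff in H as [?H H]); clear H;
  cbn [instance] in *;
  unfold meaning in *; rewrite ?csnd_pair, ?cfst_pair in *; cbv beta iota zeta in *;
  generalize dependent (r 4); generalize dependent (r 3); generalize dependent (r 2);
  generalize dependent (r 1); generalize dependent (r 0); clear r; intros.

Lemma syntax_rules_sound : Forall sound_rule syntax_rules.
Proof.
start_rules; repeat match goal with H : exists _, _ |- _ => destruct H; subst end.
all: first [refine (ex_intro _ (Var _) eq_refl) | refine (ex_intro _ Zero eq_refl)
 | refine (ex_intro _ (Succ _) eq_refl) | refine (ex_intro _ (Plus _ _) eq_refl)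
 | refine (ex_intro _ (Times _ _) eq_refl)
 | refine (ex_intro _ (Eq _ _) eq_refl) | refine (ex_intro _ (K _) eq_refl)
 | refine (ex_intro _ (Not _) eq_refl) | refine (ex_intro _ (Imp _ _) eq_refl)
 | refine (ex_intro _ (All _ _) eq_refl)
 | refine (ex_intro _ (NFree _) eq_refl) | refine (ex_intro _ NZero eq_refl)
 | refine (ex_intro _ (NSucc _) eq_refl) | refine (ex_intro _ (NPlus _ _) eq_refl)
 | refine (ex_intro _ (NTimes _ _) eq_refl) | refine (ex_intro _ (NPred _) eq_refl)
 | refine (ex_intro _ (NWit _ _ _) eq_refl)
 | refine (ex_intro _ ENil eq_refl) | refine (ex_intro _ (ECons _ _ _) eq_refl)
 | refine (ex_intro _ (Equal _ _) eq_refl) | refine (ex_intro _ (Holds _ _) eq_refl)].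
Qed.

(* decode inverts the equations between codes. *)
Ltac decode :=
  repeat first
  [ discriminate
  | match goal with
    | H : to_nat _ = to_nat _ |- _ => apply to_nat_eq in H; destruct H
    | H : tcode _ = tcode _ |- _ => apply tcode_inj in H
    | H : code _ = code _ |- _ => apply code_inj in H
    | H : ncode _ = ncode _ |- _ => apply ncode_inj in H
    | H : ecode _ = ecode _ |- _ => apply ecode_inj in H
    | H : ccode _ = ccode _ |- _ => apply ccode_inj in H
    | H : scode _ = scode _ |- _ => apply scode_inj in H
    | H : _ = scode ?A |- _ => destruct A as [[|] ?]; unfold scode in H; cbn [fst snd] in H
    | H : to_nat _ = tcode ?t |- _ => destruct t; cbn [tcode] in H
    | H : to_nat _ = code ?t |- _ => destruct t; cbn [code] in H
    | H : to_nat _ = ncode ?t |- _ => destruct t; cbn [ncode] in H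
    | H : to_nat _ = ecode ?t |- _ => destruct t; cbn [ecode] in H
    | H : to_nat _ = ccode ?t |- _ => destruct t; cbn [ccode] in H
    | H : to_nat _ = lcode ?t |- _ => destruct t; cbn [lcode] in H
    end
  | progress subst ].

Lemma evaluation_rules_sound : Forall sound_rule evaluation_rules.
Proof.
start_rules; try lia; decode; cbn [lookup]; try reflexivity.
- now rewrite Nat.eqb_refl.
- destruct (Nat.eqb_spec x n2); [congruence | auto].
- now apply H0.
- now rewrite (H0 _ _ eq_refl eq_refl).
- now rewrite (H0 _ _ eq_refl eq_refl), (H1 _ _ eq_refl eq_refl).
- now rewrite (H0 _ _ eq_refl eq_refl), (H1 _ _ eq_refl eq_refl).
Qed.

Lemma conflict_rules_sound : Forall sound_rule conflict_rules.
Proof.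
start_rules; decode; try solve [constructor].
all: specialize (H0 _ _ eq_refl eq_refl); specialize (H1 _ _ eq_refl eq_refl);
  decode; constructor.
Qed.

Lemma proof_rules_sound : Forall sound_rule proof_rules.
Proof.
start_rules;
  repeat match goal with H : exists _, _ |- _ => destruct H end;
  repeat match goal with
  | H : _ /\ _ |- _ => destruct H
  | H : to_nat _ = lcode ?s |- _ => destruct s; cbn [lcode] in H
  | H : to_nat _ = to_nat _ |- _ => apply to_nat_eq in H
  end; try discriminate; subst.
- eexists; split; [reflexivity | now left].
- edestruct H0 as (B & -> & HB); [reflexivity|]; exists B; split; [reflexivity | now right].
- exists []; split; [reflexivity | apply incl_nil_l].
- edestruct H0 as (B & -> & HB); [reflexivity|].
  edestruct H1 as (l & -> & Hl); [reflexivity|].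
  exists (B :: l); split; [reflexivity | now apply incl_cons].
- edestruct H1 as (l & -> & Hl); [reflexivity|].
  apply (refuted_conflict _ l); auto.
- match goal with A : claim |- _ => apply (refuted_split _ A); [apply H1 | apply H2] end;
    reflexivity.
- eexists; split; [reflexivity|]; apply H1; reflexivity.
- eauto using knows_provable.
- match goal with H : provable ?phi |- _ => exists (K phi) end.
  split; [reflexivity | now apply knows_known].
- match goal with |- context [to_nat (3, to_nat (code ?phi, code ?psi))] =>
    exists (K (phi ~> psi) ~> K phi ~> K psi)%fol end.
  split; [reflexivity | apply knows_distribution].
- match goal with |- context [code ?phi] => exists (K phi ~> phi)%fol end.
  split; [reflexivity | apply knows_factivity].
- decode; eexists; split; [reflexivity|]; eapply knows_modus_ponens; eassumption.
Qed.

Lemma derivable_meaning n : derivable program n -> meaning n.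
Proof.
assert (S : Forall sound_rule program).
{ unfold program; rewrite !Forall_app; auto using syntax_rules_sound,
    evaluation_rules_sound, conflict_rules_sound, proof_rules_sound. }
induction 1 as [R c HR _ IH]; rewrite Forall_forall in S.
apply (S R HR); now apply Forall_forall.
Qed.

Lemma derive_rule R (l : list nat) :
  In R program ->
  Forall (fun p => derivable program (instance (fun k => nth k l 0) p)) (premises R) ->
  derivable program (instance (fun k => nth k l 0) (conclusion R)).
Proof. intros HR H; apply derive_list; [exact HR|]; now apply Forall_forall. Qed.

(* by_rule rs l with tac applies the first rule of rs whose conclusion, under the
   values l of its variables, is the goal and whose premises tac proves. *)
Ltac find_rule rs l tac :=
  lazymatch rs with
  | ?R :: ?rs =>
      first [ refine (derive_rule R l _ _);
              [ cbn [app In program syntax_rules evaluation_rules conflict_rules proof_rules];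
                solve [repeat first [left; reflexivity | right]]
              | cbn [premises plist];
                repeat first [apply Forall_nil | apply Forall_cons]; cbn [instance nth];
                solve [tac] ]
            | find_rule rs l tac ]
  end.
Tactic Notation "by_rule" constr(rs) constr(l) "with" tactic(tac) :=
  let rs := eval red in rs in find_rule rs l tac.

Lemma derivable_term t : derivable program (to_nat (s_term, tcode t)).
Proof.
induction t; cbn [tcode].
- by_rule syntax_rules [x] with idtac.
- by_rule syntax_rules (@nil nat) with idtac.
- by_rule syntax_rules [tcode t] with (auto).
- by_rule syntax_rules [tcode t1; tcode t2] with (auto).
- by_rule syntax_rules [tcode t1; tcode t2] with (auto).
Qed.

Lemma derivable_formula phi : derivable program (to_nat (s_formula, code phi)).
Proof.
induction phi; cbn [code].
- by_rule syntax_rules [tcode t; tcode u] with (apply derivable_term).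
- by_rule syntax_rules [code phi] with (auto).
- by_rule syntax_rules [code phi] with (auto).
- by_rule syntax_rules [code phi1; code phi2] with (auto).
- by_rule syntax_rules [x; code phi] with (auto).
Qed.

Lemma derivable_name_env :
  (forall a, derivable program (to_nat (s_name, ncode a))) /\
  (forall e, derivable program (to_nat (s_env, ecode e))).
Proof.
apply name_env_mutind; intros; cbn [ncode ecode].
- by_rule syntax_rules [x] with idtac.
- by_rule syntax_rules (@nil nat) with idtac.
- by_rule syntax_rules [ncode a] with (auto).
- by_rule syntax_rules [ncode a; ncode b] with (auto).
- by_rule syntax_rules [ncode a; ncode b] with (auto).
- by_rule syntax_rules [ncode a] with (auto).
- by_rule syntax_rules [x; code phi; ecode e] with (auto using derivable_formula).
- by_rule syntax_rules (@nil nat) with idtac.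
- by_rule syntax_rules [x; ncode a; ecode e] with (auto).
Qed.

Lemma derivable_claim A : derivable program (to_nat (s_claim, ccode A)).
Proof.
destruct derivable_name_env; destruct A as [a b|e phi]; cbn [ccode].
- by_rule syntax_rules [ncode a; ncode b] with (auto).
- by_rule syntax_rules [ecode e; code phi] with (auto using derivable_formula).
Qed.

Lemma derivable_distinct x y :
  x <> y -> derivable program (to_nat (s_distinct, to_nat (x, y))).
Proof.
revert y; induction x as [|x IH]; intros [|y] H; [easy | | |].
- by_rule evaluation_rules [y] with idtac.
- by_rule evaluation_rules [x] with idtac.
- by_rule evaluation_rules [x; y] with (auto).
Qed.

Lemma derivable_lookup e x :
  derivable program (to_nat (s_lookup, to_nat (ecode e, to_nat (x, ncode (lookup e x))))).
Proof.
induction e as [|y a e IH]; cbn [ecode lookup ncode].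
- by_rule evaluation_rules [x] with idtac.
- destruct (Nat.eqb_spec y x) as [->|N].
  + by_rule evaluation_rules [x; ncode a; ecode e] with idtac.
  + by_rule evaluation_rules [y; ncode a; ecode e; x; ncode (lookup e x)]
      with (auto using derivable_distinct).
Qed.

Lemma derivable_evaluates e t :
  derivable program
    (to_nat (s_evaluates, to_nat (ecode e, to_nat (tcode t, ncode (term_name e t))))).
Proof.
unfold term_name; induction t; cbn [tcode teval ncode herbrand dom zero succ plus times].
- by_rule evaluation_rules [ecode e; x; ncode (lookup e x)] with (apply derivable_lookup).
- by_rule evaluation_rules [ecode e] with idtac.
- by_rule evaluation_rules [ecode e; tcode t; ncode (term_name e t)] with (assumption).
- by_rule evaluation_rules [ecode e; tcode t1; tcode t2;
    ncode (term_name e t1); ncode (term_name e t2)] with (assumption).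
- by_rule evaluation_rules [ecode e; tcode t1; tcode t2;
    ncode (term_name e t1); ncode (term_name e t2)] with (assumption).
Qed.

Lemma derivable_conflict l : conflict l -> derivable program (to_nat (s_conflict, lcode l)).
Proof.
destruct 1; unfold scode; cbn [lcode scode ccode ecode ncode code fst snd].
- by_rule conflict_rules [ccode A] with idtac.
- by_rule conflict_rules [ecode e; tcode t; tcode u;
    ncode (term_name e t); ncode (term_name e u)] with (apply derivable_evaluates).
- by_rule conflict_rules [ecode e; tcode t; tcode u;
    ncode (term_name e t); ncode (term_name e u)] with (apply derivable_evaluates).
- by_rule conflict_rules [ecode e; ecode e'; code phi] with idtac.
- by_rule conflict_rules [ecode e; code phi] with idtac.
- by_rule conflict_rules [ecode e; code phi] with idtac.
- by_rule conflict_rules [ecode e; code phi; code psi] with idtac.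
- by_rule conflict_rules [ecode e; code phi; code psi] with idtac.
- by_rule conflict_rules [ecode e; code phi; code psi] with idtac.
- by_rule conflict_rules [ecode e; x; code phi; ncode a] with idtac.
- by_rule conflict_rules [ecode e; x; code phi] with idtac.
- by_rule conflict_rules [ecode e; x; code phi] with idtac.
- by_rule conflict_rules [ncode a] with idtac.
- by_rule conflict_rules [ncode a] with idtac.
- by_rule conflict_rules [ncode a; ncode b; ncode c] with idtac.
- by_rule conflict_rules [ncode a; ncode b] with idtac.
- by_rule conflict_rules [ncode a; ncode b; ncode c; ncode d] with idtac.
- by_rule conflict_rules [ncode a; ncode b; ncode c; ncode d] with idtac.
- by_rule conflict_rules [ncode a] with idtac.
- by_rule conflict_rules [ncode a; ncode b] with idtac.
- by_rule conflict_rules [ncode a] with idtac.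
- by_rule conflict_rules [ncode a; ncode b] with idtac.
- by_rule conflict_rules [ncode a] with idtac.
- by_rule conflict_rules [ncode a; ncode b] with idtac.
Qed.

Lemma derivable_member A s : In A s ->
  derivable program (to_nat (s_member, to_nat (scode A, lcode s))).
Proof.
induction s as [|B s IH]; [intros []|]; intros [->|H]; cbn [lcode].
- by_rule proof_rules [scode A; lcode s] with idtac.
- by_rule proof_rules [scode A; scode B; lcode s] with (auto).
Qed.

Lemma derivable_included l s : incl l s ->
  derivable program (to_nat (s_included, to_nat (lcode l, lcode s))).
Proof.
induction l as [|A l IH]; intros H; cbn [lcode].
- by_rule proof_rules [lcode s] with idtac.
- apply incl_cons_inv in H as [HA H].
  by_rule proof_rules [scode A; lcode l; lcode s] with (auto using derivable_member).
Qed.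

Lemma derivable_refuted s : refuted s -> derivable program (to_nat (s_refuted, lcode s)).
Proof.
induction 1 as [s l C I|s A _ IH1 _ IH2].
- by_rule proof_rules [lcode s; lcode l]
    with (auto using derivable_conflict, derivable_included).
- by_rule proof_rules [lcode s; ccode A] with (auto using derivable_claim).
Qed.

Lemma derivable_provable phi :
  provable phi -> derivable program (to_nat (s_provable, code phi)).
Proof.
intros H; apply derivable_refuted in H.
by_rule proof_rules [code phi] with (auto using derivable_formula).
Qed.

Lemma derivable_knows phi : knows phi -> derivable program (to_nat (s_knows, code phi)).
Proof.
induction 1 as [phi H|phi H|phi psi|phi|phi psi _ IH1 _ IH2]; cbn [code].
- by_rule proof_rules [code phi] with (auto using derivable_provable).
- by_rule proof_rules [code phi] with (auto using derivable_provable).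
- by_rule proof_rules [code phi; code psi] with (auto using derivable_formula).
- by_rule proof_rules [code phi] with (auto using derivable_formula).
- by_rule proof_rules [code phi; code psi] with (auto).
Qed.

Lemma derivable_knows_iff n :
  derivable program (to_nat (s_knows, n)) <-> exists phi, n = code phi /\ knows phi.
Proof.
split; [|intros (phi & -> & H); now apply derivable_knows].
intros H; apply derivable_meaning in H; unfold meaning in H.
now rewrite cfst_pair, csnd_pair in H.
Qed.

Theorem theorem9 :
  exists M : structure,
    knowing_machine M /\ forall phi : formula, M |== K (K phi ~> phi).
Proof.
exists (standard knows); split; [split; [split|]|].
- now exists knows.
- exact knows_knowing_axiom.
- replace (fun n => exists phi, n = code phi /\ standard knows |== K phi)
    with (fun n => derivable program (to_nat (s_knows, n))).
  + apply recursively_enumerable_derivable.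
  + apply functional_extensionality; intros n; apply propositional_extensionality.
    rewrite derivable_knows_iff.
    split; intros (phi & E & H); exists phi; split; auto.
    * now intros ?.
    * exact (H (fun _ => 0)).
- intros phi e; apply knows_factivity.
Qed.
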